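(* For every domino tiling of the double Aztec diamond of size $n$ and overlap $\rho$, the dots of the $\mathbb L$-process on the lines $\xi=2s$, $0\le s\le 2n-\rho$, satisfy the following. (1) Numbers and colours: - for $0\le s<n-\rho$, the line $\xi=2s$ contains $n-s$ dots, all blue; - for $s=n-\rho$, it contains $\rho$ dots, all blue; - for $n-\rho<s<n$, it contains $\rho$ dots, namely $n-s$ blue dots to the right of $s-n+\rho$ red dots; - for $s=n$, it contains $\rho$ dots, all red; - for $n<s\le 2n-\rho$, it contains $\rho+s-n$ dots, all red. (2) The blue dots on consecutive lines interlace with respect to the $\eta$-coordinate, and so do the red dots: if $\beta^{(s)}_1>\beta^{(s)}_2>\cdots>\beta^{(s)}_{n-s}$ are the $\eta$-coordinates of the blue dots on $\xi=2s$, then $\beta^{(s)}_{j+1}\le\beta^{(s+1)}_j\le\beta^{(s)}_j$ for $0\le s\le n-1$, $1\le j\le n-s-1$; and if $r^{(s)}_1>\cdots>r^{(s)}_{s-n+\rho}$ are the $\eta$-coordinates of the red dots on $\xi=2s$, then $r^{(s+1)}_{j+1}\le r^{(s)}_j\le r^{(s+1)}_j$ for $n-\rho\le s\le 2n-\rho-1$, $1\le j\le s-n+\rho$. (3) In the overlap of the two diamonds all dots interlace as well: for $n-\rho<s<n$, if $\eta^{(s)}_1>\cdots>\eta^{(s)}_\rho$ are the $\eta$-coordinates of all dots on $\xi=2s$, then $$\eta^{(s+1)}_\rho\le\eta^{(s)}_\rho\le\eta^{(s+1)}_{\rho-1}\le\cdots\le\eta^{(s)}_{2}\le\eta^{(s+1)}_1\le\eta^{(s)}_1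 ;$$ that is, the right-most dot on $\xi=2s$ is to the right of the right-most dot on $\xi=2s+2$, and the left-most dot on $\xi=2s+2$ is to the left of the left-most dot on $\xi=2s$.
   Context: **Model.** $n\ge 1$, $1\le\rho\le n$ are integers with $n-\rho=2m$ even. The double Aztec diamond (two overlapping Aztec diamonds $A$, $B$ of size $n$ with overlap $\rho$) is described by its dual graph in coordinates $(\xi,\eta)$. White vertices ($x_1$ odd, $x_2$ even): $\mathtt W_{AD}=\{(x_1,x_2): 1\le x_1\le 2(2m+n)+1,\ 0\le x_2\le 2(n-1)\}\cup\{(x_1,2n):1\le x_1\le 2n-1\}$. Black vertices ($x_1$ even, $x_2$ odd): $\mathtt B_{AD}=\{(x_1,x_2):0\le x_1\le 2(2m+n),\ 1\le x_2\le 2n-1\}\cup\{(x_1,-1): 2(2m+1)\le x_1\le 2(2m+n)\}$. With $e_1=(1,1)$, $e_2=(-1,1)$, edges join a black vertex $b$ to the white vertices among $b\pm e_1$, $b\pm e_2$. A domino tiling is a perfect matching of this graph. **Dots.** There is a dot ($\mathbb L$-particle) at a black vertex $b$ iff the dimer covering $b$ is $(b,b+e_1)$ or $(b,b-e_2)$. The lines $\xi=2s$ with $n-\rho<s\le n$ are the $\rho$ lines of black squares in the overlap $A\cap B$. **Left/right.** On the lines $\xi=2s$, ''right'' means larger $\eta$; comparisons are weak: a dot $x$ is to the right of a dot $y$ when $\eta(x)\ge\eta(y)$. **Colours.** A domino tiling defines a height function; along the line $\xi=2s$ its value at the right end (largest $\eta$) is $\min(s,n)$, and, moving from right to left, it increases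 by $1$ exactly when passing a dot and is otherwise constant. A dot at which the height passes from $h$ to $h+1$ lies on the level curve of height $h+\tfrac12$; it is blue if $h+\tfrac12\le n-\tfrac12$ (an $A$-level curve) and red if $h+\tfrac12\ge n+\tfrac12$ (a $B$-level curve). *)

(* Defs.v *)
From mathcomp Require Import all_boot all_order all_algebra.
From mathcomp Require Export finmap.

Set Implicit Arguments.
Unset Strict Implicit.
Unset Printing Implicit Defensive.

Import Order.TTheory GRing.Theory Num.Theory.
Local Open Scope fset_scope.
Local Open Scope ring_scope.

(* (xi, eta) coordinates. *)
Definition point := (int * int)%type.

Definition e1 : point := (1, 1).
Definition e2 : point := (-1, 1).

(* Here [n] is the size and [m] is half of [n - rho]. *)
Definition white (n m : nat) (x : point) : bool :=
  [&& ~~ (2 %| x.1)%Z, (2 %| x.2)%Z &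
      [&& 1 <= x.1, x.1 <= 2 * (2 * m%:Z + n%:Z) + 1,
          0 <= x.2 & x.2 <= 2 * (n%:Z - 1)]
      || [&& x.2 == 2 * n%:Z, 1 <= x.1 & x.1 <= 2 * n%:Z - 1]].

Definition black (n m : nat) (x : point) : bool :=
  [&& (2 %| x.1)%Z, ~~ (2 %| x.2)%Z &
      [&& 0 <= x.1, x.1 <= 2 * (2 * m%:Z + n%:Z),
          1 <= x.2 & x.2 <= 2 * n%:Z - 1]
      || [&& x.2 == -1, 2 * (2 * m%:Z + 1) <= x.1
           & x.1 <= 2 * (2 * m%:Z + n%:Z)]].

(* An edge is written as a pair (black end, white end). *)
Definition is_edge (n m : nat) (d : point * point) : bool :=
  [&& black n m d.1, white n m d.2 &
      d.2 \in [:: d.1 + e1; d.1 - e1; d.1 + e2; d.1 - e2]].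

Definition domino_tiling (n m : nat) (M : {fset point * point}) : Prop :=
  [/\ forall d, d \in M -> is_edge n m d,
      forall b, black n m b -> exists! w, (b, w) \in M
    & forall w, white n m w -> exists! b, (b, w) \in M].

Definition is_dot (M : {fset point * point}) (b : point) : bool :=
  ((b, b + e1) \in M) || ((b, b - e2) \in M).

(* The dots on the line xi = 2 s. *)
Definition dots (M : {fset point * point}) (s : nat) : {fset point} :=
  [fset b in [fset d.1 | d in M] | is_dot M b && (b.1 == 2 * s%:Z)].

(* The height on the line xi = 2 s: it is [minn s n] at the right end and gains
   1 at each dot passed when moving left.  At the position y of a dot, where
   the height jumps, this is the value immediately to the right of the dot. *)
Definition height (n : nat) (M : {fset point * point}) (s : nat) (y : int)
  : nat := (minn s n + #|` [fset d in dots M s | (y < d.2)%R]|)%N.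

(* The height h + 1/2 of the level curve through a dot x of the line xi = 2 s
   at which the height passes from h to h + 1. *)
Definition level (n : nat) (M : {fset point * point}) (s : nat) (x : point)
  : rat := (height n M s x.2)%:R + 1 / 2.

Definition blue_dots (n : nat) (M : {fset point * point}) (s : nat)
  : {fset point} := [fset x in dots M s | level n M s x <= n%:R - 1 / 2].

Definition red_dots (n : nat) (M : {fset point * point}) (s : nat)
  : {fset point} := [fset x in dots M s | n%:R + 1 / 2 <= level n M s x].

(* Weak comparison. *)
Definition right_of (x y : point) : bool := y.2 <= x.2.

(* The j-th largest eta-coordinate, j = 1, 2, and so on, of a set of points;
   the value is 0 when j exceeds the number of points.  It is meant for points
   on one line, which have pairwise distinct eta-coordinates. *)
Definition eta (D : {fset point}) (j : nat) : int :=
  nth 0 (sort >=%R [seq x.2 | x <- enum_fset D]) j.-1.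

(* Main.v *)
Require Import Defs.
From mathcomp Require Import all_boot all_order all_algebra.
From mathcomp Require Import finmap.
From mathcomp Require Import zify.

(** Everything follows from one double counting on the column of white squares
    [xi = 2 s + 1].  A white square of this column is matched either to a black
    square of the line [xi = 2 s], which is then a dot, or to a black square of
    the line [xi = 2 s + 2], which is then not a dot; and every dot of
    [xi = 2 s], every non-dot of [xi = 2 s + 2] arises exactly once in this
    way.  The [eta] coordinates of matched squares differ by 1.  So for each odd
    [y] the dots of [xi = 2 s] and the non-dots of [xi = 2 s + 2] with [eta >= y]
    are together at least as many as the white squares with [eta > y] and at
    most as many as the white squares with [eta > y - 2].  Since the non-dots are
    the black squares minus the dots, and all columns are explicit segments,
    this compares the number of dots with [eta >= y] on two consecutive
    lines ([dots_from_step]): for [s < n] it stays the same or drops by 1, for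
    [s >= n] it stays the same or grows by 1.

    At the lowest threshold all dots are counted, the lower and upper bounds
    coincide, and starting from the line [xi = 0], all of whose black squares
    are dots, one gets the number of dots on each line ([card_dots]).  At a
    general threshold, the comparison of these counting functions is the
    interlacing of the two decreasing sequences of dots
    ([dots_interlace_left], [dots_interlace_right]), because the j-th largest
    entry is at least [y] exactly when at least j entries are
    ([le_nth_sorted]).

    The height just to the right of the dot with [i] dots to its right is
    [minn s n + i], so a dot is blue exactly when it is one of the [n - s]
    right-most dots ([etas_blue], [etas_red]).  Hence the colours form a prefix
    and a suffix of the sequence of dots.  As long as [s < n], the prefix loses
    one dot at each step; this shifts the indices of the red dots, so that the
    same interlacing of all dots reads as the opposite interlacing of the red
    ones. *)

Set Implicit Arguments.
Unset Strict Implicit.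
Unset Printing Implicit Defensive.

Import Order.TTheory GRing.Theory Num.Theory.
Local Open Scope fset_scope.
Local Open Scope ring_scope.

(** * Decreasing sequences *)

(** This turns inequalities between order statistics into inequalities between
    counting functions. *)
Lemma le_nth_sorted (R : realDomainType) (s : seq R) (i : nat) (y : R) :
  sorted >=%R s -> (i < size s)%N ->
  (y <= nth 0 s i) = (i < count (fun v => (y <= v)%R) s)%N.
Proof.
elim: s i => // x s IHs i; rewrite /= (path_sortedE ge_trans).
case/andP=> /allP le_s_x sorted_s; case: i => [|i] lt_i /=.
  case: (leP y x) => // lt_x_y; symmetry; rewrite add0n.
  apply: negbTE; rewrite -has_count; apply/hasPn => v /le_s_x.
  by move=> /le_lt_trans/(_ lt_x_y); rewrite ltNge.
case: (leP y x) => [le_y_x|lt_x_y]; first by rewrite (IHs i sorted_s lt_i).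
have small v : v \in s -> (y <= v) = false.
  by move=> /le_s_x /le_lt_trans/(_ lt_x_y) lt_v_y; rewrite leNgt lt_v_y.
rewrite (small _ (mem_nth _ lt_i)) (eq_in_count small).
by rewrite count_pred0.
Qed.

(** In a strictly decreasing sequence the number of entries above an entry is
    its index, so a bound on that number cuts the sequence in two at the
    bound. *)
Lemma filter_rank (R : realDomainType) (s : seq R) (k : nat) :
  sorted >%R s ->
  [seq v <- s | (count (fun w => (v < w)%R) s < k)%N] = take k s /\
  [seq v <- s | (k <= count (fun w => (v < w)%R) s)%N] = drop k s.
Proof.
elim: s k => // x s IHs k; rewrite /= (path_sortedE (rev_trans lt_trans)).
case/andP=> /allP lt_s_x sorted_s.
have -> : count (fun w => (x < w)%R) s = 0%N.
  rewrite (@eq_in_count _ _ pred0) ?count_pred0 // => w /lt_s_x lt_w_x.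
  by rewrite lt_gtF.
(* The head lies above every entry of the tail, hence shifts the count by 1. *)
have rank_lt v : v \in s -> ((v < x)%R + count (fun w => (v < w)%R) s < k)%N
    = (count (fun w => (v < w)%R) s < k.-1)%N.
  by move=> /lt_s_x /= ->; case: (k).
have rank_ge v : v \in s -> (k <= (v < x)%R + count (fun w => (v < w)%R) s)%N
    = (k.-1 <= count (fun w => (v < w)%R) s)%N.
  by move=> /lt_s_x /= ->; case: (k).
rewrite ltxx (eq_in_filter rank_lt) (eq_in_filter rank_ge).
have [-> ->] := IHs k.-1 sorted_s.
by case: (k) => //=; rewrite take0 drop0.
Qed.

(** * Points listed by decreasing second coordinate *)

Definition etas (D : {fset point}) : seq int :=
  sort >=%R [seq x.2 | x <- enum_fset D].

Definition rank (D : {fset point}) (x : point) : nat :=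
  count (fun d : point => (x.2 < d.2)%R) (enum_fset D).

Lemma ge_int_total : total (>=%R : rel int).
Proof. by move=> x y; rewrite orbC; apply: le_total. Qed.

Lemma etas_sorted D : sorted >=%R (etas D).
Proof. exact: (sort_sorted ge_int_total). Qed.

Lemma size_etas D : size (etas D) = #|` D|.
Proof. by rewrite size_sort size_map. Qed.

Lemma etas_gt_sorted (D : {fset point}) :
  {in D &, injective (snd : point -> int)} -> sorted >%R (etas D).
Proof.
move=> injD.
suff: sorted (fun x y : int => (y < x)%R) (etas D) by [].
have uniq_etas: uniq (etas D) by rewrite sort_uniq map_inj_in_uniq // fset_uniq.
have := etas_sorted D; elim: (etas D) uniq_etas => //= x s IHs /andP[xs us].
rewrite !(path_sortedE ge_trans, path_sortedE (rev_trans lt_trans)).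
case/andP=> /allP le_s_x /(IHs us) ->; rewrite andbT; apply/allP => v vs.
rewrite /= lt_neqAle; move: (le_s_x v vs) => /= ->; rewrite andbT.
by apply: contraNneq xs => <-.
Qed.

Lemma card_sep (D : {fset point}) (P : pred point) :
  #|` [fset x in D | P x]| = count P (enum_fset D).
Proof.
rewrite -size_filter; apply: perm_size; apply: uniq_perm => [||x].
- exact: fset_uniq.
- by rewrite filter_uniq // fset_uniq.
by rewrite mem_filter !inE andbC.
Qed.

(** A condition on points that only depends on the second coordinate may be
    tested on the sorted list. *)
Lemma etas_sep (D : {fset point}) (P : pred point) (Q : pred int) :
  {in D, forall x, P x = Q x.2} ->
  etas [fset x in D | P x] = [seq v <- etas D | Q v].
Proof.
move=> PQ; rewrite /etas (filter_sort ge_int_total ge_trans).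
apply/(perm_sortP ge_int_total ge_trans ge_anti).
rewrite filter_map; apply: perm_map.
apply: uniq_perm => [||x]; rewrite ?filter_uniq ?fset_uniq //.
rewrite mem_filter !inE /=.
by case xD: (x \in enum_fset D); rewrite ?andbF //= -PQ ?andbT.
Qed.

Lemma count_etas (D : {fset point}) (Q : pred int) :
  count Q (etas D) = count (fun x : point => Q x.2) (enum_fset D).
Proof. by rewrite count_sort count_map. Qed.

Lemma etas_rank_lt (D : {fset point}) (k : nat) :
  {in D &, injective (snd : point -> int)} ->
  etas [fset x in D | (rank D x < k)%N] = take k (etas D).
Proof.
move=> /etas_gt_sorted /(filter_rank k)[<- _].
by apply: etas_sep => x _; rewrite count_etas.
Qed.

Lemma etas_rank_ge (D : {fset point}) (k : nat) :
  {in D &, injective (snd : point -> int)} ->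
  etas [fset x in D | (k <= rank D x)%N] = drop k (etas D).
Proof.
move=> /etas_gt_sorted /(filter_rank k)[_ <-].
by apply: etas_sep => x _; rewrite count_etas.
Qed.

(** The only threshold that matters is [eta D i], which is the coordinate of a
    point of [D]; so the counting functions need only be compared there. *)
Lemma eta_le_eta (D D' : {fset point}) (i j : nat) :
  (0 < i <= #|` D|)%N -> (0 < j <= #|` D'|)%N ->
  {in D, forall x, (i <= count (fun d : point => (x.2 <= d.2)%R) (enum_fset D))%N ->
         (j <= count (fun d : point => (x.2 <= d.2)%R) (enum_fset D'))%N} ->
  eta D i <= eta D' j.
Proof.
case: i j => // i [|j] //= lt_i lt_j le_counts.
have: eta D i.+1 \in etas D by rewrite mem_nth // size_etas.
rewrite mem_sort => /mapP[x xD def_x]; rewrite def_x.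
rewrite (le_nth_sorted _ (etas_sorted D')) ?size_etas // count_etas.
apply: le_counts => //; rewrite -def_x -count_etas.
by rewrite -(le_nth_sorted _ (etas_sorted D)) ?size_etas.
Qed.

(** * The matching and its columns *)

Lemma tiling_edge (n m : nat) (M : {fset point * point}) (d : point * point) :
  domino_tiling n m M -> d \in M ->
  [/\ black n m d.1, white n m d.2,
      d.2.1 = d.1.1 + 1 \/ d.2.1 = d.1.1 - 1
    & d.2.2 = d.1.2 + 1 \/ d.2.2 = d.1.2 - 1].
Proof.
case=> edgeM _ _ /edgeM /and3P[-> -> ]; rewrite !inE.
by case/or4P=> /eqP -> /=; split=> //; rewrite ?opprK; auto.
Qed.

Lemma black_matched_once (n m : nat) (M : {fset point * point}) :
  domino_tiling n m M -> {in M &, injective (fst : point * point -> point)}.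
Proof.
move=> hM [b w] [b' w'] dM dM' /= eq_b; subst b'; case: (hM) => _ match_b _.
have [black_b _ _ _] := tiling_edge hM dM.
by case: (match_b b black_b) => w0 [_ unw]; rewrite -(unw w) // -(unw w').
Qed.

Lemma white_matched_once (n m : nat) (M : {fset point * point}) :
  domino_tiling n m M -> {in M &, injective (snd : point * point -> point)}.
Proof.
move=> hM [b w] [b' w'] dM dM' /= eq_w; subst w'; case: (hM) => _ _ match_w.
have [_ white_w _ _] := tiling_edge hM dM.
by case: (match_w w white_w) => b0 [_ unb]; rewrite -(unb b) // -(unb b').
Qed.

(** Counting dimers by their black end is counting black squares, as the
    matching covers each of them exactly once. *)
Lemma count_black (n m : nat) (M : {fset point * point}) (P : pred point)
    (l : seq point) :
  domino_tiling n m M -> uniq l -> (forall b, (b \in l) = black n m b && P b) ->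
  count (fun d : point * point => P d.1) (enum_fset M) = size l.
Proof.
move=> hM uniq_l mem_l.
rewrite -size_filter -(size_map (fst : point * point -> point)).
apply/perm_size/uniq_perm => // [|b].
  rewrite map_inj_in_uniq ?filter_uniq ?fset_uniq // => d d'.
  by rewrite !mem_filter => /andP[_ dM] /andP[_]; apply: black_matched_once hM _ _ dM.
rewrite mem_l; apply/mapP/andP=> [[d]|[black_b Pb]].
  rewrite mem_filter => /andP[Pd dM] ->.
  by have [] := tiling_edge hM dM.
case: (hM) => _ /(_ b black_b)[w [dM _]] _.
by exists (b, w); rewrite // mem_filter dM andbT.
Qed.

Lemma count_white (n m : nat) (M : {fset point * point}) (P : pred point)
    (l : seq point) :
  domino_tiling n m M -> uniq l -> (forall w, (w \in l) = white n m w && P w) ->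
  count (fun d : point * point => P d.2) (enum_fset M) = size l.
Proof.
move=> hM uniq_l mem_l.
rewrite -size_filter -(size_map (snd : point * point -> point)).
apply/perm_size/uniq_perm => // [|w].
  rewrite map_inj_in_uniq ?filter_uniq ?fset_uniq // => d d'.
  by rewrite !mem_filter => /andP[_ dM] /andP[_]; apply: white_matched_once hM _ _ dM.
rewrite mem_l; apply/mapP/andP=> [[d]|[white_w Pw]].
  rewrite mem_filter => /andP[Pd dM] ->.
  by have [] := tiling_edge hM dM.
case: (hM) => _ _ /(_ w white_w)[b [dM _]].
by exists (b, w); rewrite // mem_filter dM andbT.
Qed.

Definition column_segment (x c : int) (a len : nat) : seq point :=
  [seq (x, 2 * i%:Z + c) | i <- iota a len].

Lemma column_segment_uniq x c a len : uniq (column_segment x c a len).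
Proof.
rewrite map_inj_uniq ?iota_uniq // => i j [eq_ij].
by lia.
Qed.

Lemma mem_column_segment (x c : int) (a len : nat) (z : point) :
  (z \in column_segment x c a len) =
  [&& z.1 == x, (2 %| z.2 - c)%Z, 2 * a%:Z + c <= z.2
    & z.2 < 2 * (a + len)%N%:Z + c].
Proof.
case: z => z1 z2 /=; apply/mapP/idP => [[i] | ].
  by rewrite mem_iota => lt_i [-> ->]; lia.
case/and4P => /eqP-> even_z ge_z lt_z; exists `|(z2 - c) %/ 2|%Z%N.
  by rewrite mem_iota; lia.
by congr pair; lia.
Qed.

(** The square with [eta = -1] is present only on the lines [s > 2 m]; this is what
    the boolean [s <= 2 * m], used as a number, records at [k = 0]. *)
Lemma count_black_column (n m : nat) (M : {fset point * point}) (s k : nat) :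
  domino_tiling n m M -> (s <= 2 * m + n)%N ->
  count (fun d : point * point =>
           (d.1.1 == 2 * s%:Z) && (2 * k%:Z - 1 <= d.1.2)) (enum_fset M)
  = (n.+1 - maxn k (s <= 2 * m))%N.
Proof.
move=> hM le_s; set a := maxn _ _.
pose P b := (b.1 == 2 * s%:Z) && (2 * k%:Z - 1 <= b.2) : bool.
rewrite (count_black (P := P) (l := column_segment (2 * s%:Z) (-1) a (n.+1 - a)) hM).
- by rewrite size_map size_iota.
- exact: column_segment_uniq.
move=> [b1 b2]; rewrite mem_column_segment /black /P /= /a {P a}.
by case: eqP => [->|]; lia.
Qed.

(** The square with [eta = 2 n] is present only in the columns [s < n], whence
    the boolean [s < n] used as a number. *)
Lemma count_white_column (n m : nat) (M : {fset point * point}) (s k : nat) :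
  domino_tiling n m M -> (s <= 2 * m + n)%N ->
  count (fun d : point * point =>
           (d.2.1 == 2 * s%:Z + 1) && (2 * k%:Z <= d.2.2)) (enum_fset M)
  = (n + (s < n) - k)%N.
Proof.
move=> hM le_s; set a := (n + (s < n))%N.
pose P b := (b.1 == 2 * s%:Z + 1) && (2 * k%:Z <= b.2) : bool.
rewrite (count_white (P := P) (l := column_segment (2 * s%:Z + 1) 0 k (a - k)) hM).
- by rewrite size_map size_iota.
- exact: column_segment_uniq.
move=> [b1 b2]; rewrite mem_column_segment /white /P /= /a {P a}.
by case: eqP => [->|]; lia.
Qed.

(** * Dots on consecutive lines *)

(** The directions [e1] and [- e2] are those that increase [xi], so a dot is a
    black square matched to the next white column. *)
Lemma mem_dots (n m : nat) (M : {fset point * point}) (s : nat) (b : point) :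
  domino_tiling n m M ->
  reflect (exists2 d, d \in M &
             [/\ d.1 = b, d.1.1 = 2 * s%:Z & d.2.1 = 2 * s%:Z + 1])
          (b \in dots M s).
Proof.
move=> hM; apply: (iffP idP) => [|[[b' w] dM [/= eq_b b_s w_s]]].
  rewrite !inE /= => /andP[_ /andP[dot_b /eqP b_s]].
  have [] := orP dot_b => dM; [exists (b, b + e1) | exists (b, b - e2)] => //=.
  - by split; rewrite ?b_s.
  - by split; rewrite ?b_s ?opprK.
subst b'; rewrite !inE /= b_s eqxx andbT; apply/andP; split.
  by apply/imfsetP; exists (b, w).
case: (hM) => /(_ _ dM) /and3P[/= _ _]; rewrite !inE => /or4P edge _ _.
rewrite /is_dot; case: edge => /eqP def_w; rewrite def_w in dM w_s;
  by rewrite ?dM ?orbT //; move: w_s; rewrite /= b_s; lia.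
Qed.

Lemma count_dots (n m : nat) (M : {fset point * point}) (s : nat) (Q : pred int) :
  domino_tiling n m M ->
  count (fun x : point => Q x.2) (enum_fset (dots M s)) =
  count (fun d : point * point =>
           [&& d.1.1 == 2 * s%:Z, d.2.1 == 2 * s%:Z + 1 & Q d.1.2]) (enum_fset M).
Proof.
move=> hM; rewrite -!size_filter -[RHS](size_map (fst : point * point -> point)).
apply/perm_size/uniq_perm => [||b].
- by rewrite filter_uniq ?fset_uniq.
- rewrite map_inj_in_uniq ?filter_uniq ?fset_uniq // => d d'.
  by rewrite !mem_filter => /andP[_ dM] /andP[_]; apply: black_matched_once hM _ _ dM.
rewrite mem_filter; apply/andP/mapP => [[Qb /(mem_dots _ _ hM)[d dM []]]|].
  by move=> db d1 d2; exists d; rewrite ?mem_filter ?dM ?d1 ?d2 ?db ?Qb ?eqxx.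
case=> d; rewrite mem_filter => /andP[/and3P[/eqP d1 /eqP d2 Qd] dM] ->.
by split=> //; apply/(mem_dots _ _ hM); exists d.
Qed.

Lemma count_split (T : Type) (P Q : pred T) (s : seq T) :
  count P s = (count (fun x => P x && Q x) s + count (fun x => P x && ~~ Q x) s)%N.
Proof. by elim: s => //= x s ->; case: (P x); case: (Q x) => /=; lia. Qed.

(** The [eta] coordinates of black squares are the odd numbers [2 k - 1] with
    [k] natural, so that these thresholds suffice; [k = 0] counts all dots. *)
Definition dots_from (M : {fset point * point}) (s k : nat) : nat :=
  count (fun x : point => 2 * k%:Z - 1 <= x.2) (enum_fset (dots M s)).

(** The double counting on the white column between two lines.  In the middle,
    the second term is the number of black squares on the line [s + 1] with
    [eta >= 2 k - 1]; on the outer sides stand the numbers of white squares with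
    [eta >= 2 k] and with [eta >= 2 k - 2].  For [k = 0] the truncated
    predecessor makes the two outer sides equal, as no white square has a
    negative [eta], and the comparison is an equality. *)
Lemma dots_from_step (n m : nat) (M : {fset point * point}) (s k : nat) :
  domino_tiling n m M -> (s < 2 * m + n)%N ->
  (n + (s < n) - k + dots_from M s.+1 k <=
   dots_from M s k + (n.+1 - maxn k (s < 2 * m)) <=
   n + (s < n) - k.-1 + dots_from M s.+1 k)%N.
Proof.
move=> hM lt_s; rewrite /dots_from !(count_dots _ (fun y => 2 * k%:Z - 1 <= y) hM).
rewrite -(count_black_column k hM lt_s).
rewrite -!(count_white_column _ hM (ltnW lt_s)).
set whites := (X in (X + _ <= _ <= _)%N).
set whites' := (X in (_ <= _ <= X + _)%N).
set C := (X in (_ <= X + _ <= _)%N); set C' := (X in (_ + X <= _)%N).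
(* The dimers of this white column, thresholded at their black end. *)
pose touching := count (fun d : point * point =>
  (d.2.1 == 2 * s%:Z + 1) && (2 * k%:Z - 1 <= d.1.2)) (enum_fset M).
have geo d := @tiling_edge n m M d hM.
have le_whites: (whites <= touching)%N.
  rewrite /whites /touching -!size_filter; apply: uniq_leq_size => [|d].
    by rewrite filter_uniq ?fset_uniq.
  rewrite !mem_filter => /andP[/andP[-> ge_k] dM]; rewrite dM andbT /=.
  by case: (geo d dM) => _ _ _ []; lia.
have ge_whites: (touching <= whites')%N.
  rewrite /whites' /touching -!size_filter; apply: uniq_leq_size => [|d].
    by rewrite filter_uniq ?fset_uniq.
  rewrite !mem_filter => /andP[/andP[-> ge_k] dM]; rewrite dM andbT /=.
  by case: (geo d dM) => _ /and3P[_ _ +] _ []; lia.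
(* Those among them that come from the line [s + 1], that is, its non-dots. *)
pose other := count (fun d : point * point =>
  [&& d.1.1 == 2 * s.+1%:Z, 2 * k%:Z - 1 <= d.1.2 & d.2.1 == 2 * s%:Z + 1])
  (enum_fset M).
have eq_touching: touching = (C + other)%N.
  rewrite /touching (count_split _ (fun d => d.1.1 == 2 * s%:Z)); congr addn.
    by apply: eq_count => d; rewrite /= andbC.
  apply: eq_in_count => -[[b1 b2] [w1 w2]] /geo /= [_ _ + _].
  by clear; lia.
have eq_blacks: count (fun d : point * point =>
    (d.1.1 == 2 * s.+1%:Z) && (2 * k%:Z - 1 <= d.1.2)) (enum_fset M)
    = (C' + other)%N.
  rewrite (count_split _ (fun d => d.2.1 == 2 * s.+1%:Z + 1)); congr addn.
    by apply: eq_count => d; rewrite /= -andbA (andbC (_ <= _)).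
  apply: eq_in_count => -[[b1 b2] [w1 w2]] /geo /= [_ _ + _].
  by clear; lia.
by rewrite eq_blacks; lia.
Qed.

(** No white column lies to the left of [xi = 0], so all its black squares are
    dots. *)
Lemma dots_from_line0 (n m : nat) (M : {fset point * point}) (k : nat) :
  domino_tiling n m M -> dots_from M 0%N k = (n.+1 - maxn k 1)%N.
Proof.
move=> hM; rewrite -(count_black_column (s := 0%N) k hM) //.
rewrite /dots_from (count_dots _ (fun y => 2 * k%:Z - 1 <= y) hM).
have geo d := @tiling_edge n m M d hM.
apply: eq_in_count => -[[b1 b2] [w1 w2]] /geo [_ /and3P[_ _ +] + _].
rewrite /dots /=; clear; lia.
Qed.

Lemma dots_position (n m : nat) (M : {fset point * point}) (s : nat) (x : point) :
  domino_tiling n m M -> x \in dots M s ->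
  x.1 = 2 * s%:Z /\ exists2 k : nat, (k <= n)%N & x.2 = 2 * k%:Z - 1.
Proof.
move=> hM /(mem_dots _ _ hM)[d dM [<- d1 _]]; split=> //.
have [+ _ _ _] := tiling_edge hM dM; case: d.1 => b1 b2; rewrite /black /= => black_b.
by exists `|(b2 + 1) %/ 2|%Z%N; lia.
Qed.

Lemma dots_snd_inj (n m : nat) (M : {fset point * point}) (s : nat) :
  domino_tiling n m M -> {in dots M s &, injective (snd : point -> int)}.
Proof.
move=> hM [x1 x2] [y1 y2] /(dots_position hM)[/= -> _].
by move=> /(dots_position hM)[/= -> _] ->.
Qed.

Lemma card_dots_from (n m : nat) (M : {fset point * point}) (s : nat) :
  domino_tiling n m M -> #|` dots M s| = dots_from M s 0%N.
Proof.
move=> hM; rewrite /dots_from -[LHS]count_predT; apply: eq_in_count => x xD.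
by have [_ [k _ /= ->]] := dots_position hM xD; lia.
Qed.

(** Induction on [s] with the case [k = 0] of [dots_from_step]: the number of
    dots drops by 1 up to [s = 2 m], is constant up to [s = n], and then grows
    by 1. *)
Lemma card_dots (n m : nat) (M : {fset point * point}) (s : nat) :
  domino_tiling n m M -> (s <= 2 * m + n)%N -> (2 * m <= n)%N ->
  #|` dots M s| = (n - minn s (2 * m) + (s - n))%N.
Proof.
move=> hM le_s le_mn; rewrite (card_dots_from _ hM).
elim: s le_s => [|s IHs] lt_s; first by rewrite (dots_from_line0 _ hM); lia.
have := dots_from_step 0%N hM lt_s; rewrite IHs ?(ltnW lt_s) //.
by lia.
Qed.

(** For [s < n] the number of dots above a given threshold stays the same or drops
    by 1 from [s] to [s + 1]. *)
Lemma dots_interlace_left (n m : nat) (M : {fset point * point}) (s j : nat) :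
  domino_tiling n m M -> (2 * m <= n)%N -> (s < n)%N -> (0 < j)%N ->
  ((j <= #|` dots M s.+1|)%N -> eta (dots M s.+1) j <= eta (dots M s) j) /\
  ((j < #|` dots M s|)%N -> eta (dots M s) j.+1 <= eta (dots M s.+1) j).
Proof.
move=> hM le_mn lt_s j_gt0.
have lt_sN: (s < 2 * m + n)%N by lia.
have cardE := card_dots hM _ le_mn.
have card_s := cardE s (ltnW lt_sN); have card_s1 := cardE s.+1 lt_sN.
split=> le_j; apply: eta_le_eta; try lia;
  move=> x /(dots_position hM)[_ [k le_k ->]];
  rewrite -!/(dots_from _ _ k);
  have := dots_from_step k hM lt_sN;
  case: k le_k => [|k] le_k; rewrite -?(card_dots_from _ hM); lia.
Qed.

(** For [s >= n] the white columns are shorter by one square, which reverses the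
    comparison of the two lines. *)
Lemma dots_interlace_right (n m : nat) (M : {fset point * point}) (s j : nat) :
  domino_tiling n m M -> (2 * m <= n)%N -> (n <= s < 2 * m + n)%N ->
  (0 < j <= #|` dots M s|)%N ->
  eta (dots M s.+1) j.+1 <= eta (dots M s) j
  /\ eta (dots M s) j <= eta (dots M s.+1) j.
Proof.
move=> hM le_mn /andP[le_s lt_sN] /andP[j_gt0 le_j].
have cardE := card_dots hM _ le_mn.
have card_s := cardE s (ltnW lt_sN); have card_s1 := cardE s.+1 lt_sN.
split; apply: eta_le_eta; try lia;
  move=> x /(dots_position hM)[_ [k le_k ->]];
  rewrite -!/(dots_from _ _ k);
  have := dots_from_step k hM lt_sN;
  case: k le_k => [|k] le_k; rewrite -?(card_dots_from _ hM); lia.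
Qed.

(** * Colours *)

(** The bound [n - s] is truncated: it vanishes for [s >= n], where the height is
    at least [n] everywhere. *)
Lemma level_blue (n : nat) (M : {fset point * point}) (s : nat) (x : point) :
  (level n M s x <= n%:R - 1 / 2) = (rank (dots M s) x < n - s)%N.
Proof.
rewrite /level /height card_sep -/(rank _ _).
rewrite lerBrDr -addrA -mulrDl divff // natr1 ler_nat; lia.
Qed.

Lemma level_red (n : nat) (M : {fset point * point}) (s : nat) (x : point) :
  (n%:R + 1 / 2 <= level n M s x) = (n - s <= rank (dots M s) x)%N.
Proof.
rewrite /level /height card_sep -/(rank _ _) lerD2r ler_nat; lia.
Qed.

(** A colour is a bound on the number of dots to the right, so it cuts the sorted
    list of dots in two. *)
Lemma etas_blue (n m : nat) (M : {fset point * point}) (s : nat) :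
  domino_tiling n m M -> etas (blue_dots n M s) = take (n - s) (etas (dots M s)).
Proof.
move=> hM; rewrite -(etas_rank_lt _ (dots_snd_inj (s := s) hM)); congr etas.
by apply/fsetP => x; rewrite !inE level_blue.
Qed.

Lemma etas_red (n m : nat) (M : {fset point * point}) (s : nat) :
  domino_tiling n m M -> etas (red_dots n M s) = drop (n - s) (etas (dots M s)).
Proof.
move=> hM; rewrite -(etas_rank_ge _ (dots_snd_inj (s := s) hM)); congr etas.
by apply/fsetP => x; rewrite !inE level_red.
Qed.

Lemma card_blue (n m : nat) (M : {fset point * point}) (s : nat) :
  domino_tiling n m M -> #|` blue_dots n M s| = minn (n - s) #|` dots M s|.
Proof.
by move=> hM; rewrite -!size_etas (etas_blue _ hM) size_take_min.
Qed.

Lemma card_red (n m : nat) (M : {fset point * point}) (s : nat) :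
  domino_tiling n m M -> #|` red_dots n M s| = (#|` dots M s| - (n - s))%N.
Proof. by move=> hM; rewrite -!size_etas (etas_red _ hM) size_drop. Qed.

Lemma eta_blue (n m : nat) (M : {fset point * point}) (s j : nat) :
  domino_tiling n m M -> (0 < j <= n - s)%N ->
  eta (blue_dots n M s) j = eta (dots M s) j.
Proof.
move=> hM le_j; rewrite /eta -!/(etas _) (etas_blue _ hM) nth_take //.
by lia.
Qed.

Lemma eta_red (n m : nat) (M : {fset point * point}) (s j : nat) :
  domino_tiling n m M -> (0 < j)%N ->
  eta (red_dots n M s) j = eta (dots M s) (n - s + j).
Proof.
move=> hM j_gt0; rewrite /eta -!/(etas _) (etas_red _ hM) nth_drop.
by congr nth; lia.
Qed.

Lemma blue_all (n m : nat) (M : {fset point * point}) (s : nat) :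
  domino_tiling n m M -> (#|` dots M s| <= n - s)%N ->
  blue_dots n M s = dots M s.
Proof.
move=> hM le_card; apply/eqP; rewrite eqEfcard fset_sub /=.
by rewrite (card_blue _ hM) leq_min le_card leqnn.
Qed.

Lemma red_all (n m : nat) (M : {fset point * point}) (s : nat) :
  domino_tiling n m M -> (n <= s)%N -> red_dots n M s = dots M s.
Proof.
move=> hM le_s; apply/eqP; rewrite eqEfcard fset_sub /=.
by rewrite (card_red _ hM) (eqP le_s) subn0.
Qed.

Lemma blue_right_of_red (n : nat) (M : {fset point * point}) (s : nat)
    (x y : point) :
  x \in blue_dots n M s -> y \in red_dots n M s -> right_of x y.
Proof.
rewrite !inE => /andP[_ +] /andP[_ +]; rewrite level_blue level_red.
move=> rank_x rank_y; rewrite /right_of leNgt; apply/negP => lt_xy.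
suff: (rank (dots M s) y <= rank (dots M s) x)%N by lia.
by apply: sub_count => d /=; apply: lt_trans.
Qed.

Theorem proposition1p3 (n rho m : nat) (hn : (1 <= n)%N)
    (hrho1 : (1 <= rho)%N) (hrhon : (rho <= n)%N)
    (hm : (n - rho = 2 * m)%N)
    (M : {fset point * point}) (hM : domino_tiling n m M) :
  (* (1) numbers and colours *)
  [/\ forall s : nat, (s < n - rho)%N ->
        #|` dots M s| = (n - s)%N /\ blue_dots n M s = dots M s,
      #|` dots M (n - rho)| = rho
        /\ blue_dots n M (n - rho) = dots M (n - rho),
      forall s : nat, (n - rho < s)%N -> (s < n)%N ->
        [/\ #|` dots M s| = rho,
            #|` blue_dots n M s| = (n - s)%N,
            #|` red_dots n M s| = (s + rho - n)%N
          & forall x y : point, x \in blue_dots n M s ->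
              y \in red_dots n M s -> right_of x y],
      #|` dots M n| = rho /\ red_dots n M n = dots M n
    & forall s : nat, (n < s)%N -> (s <= 2 * n - rho)%N ->
        #|` dots M s| = (rho + s - n)%N /\ red_dots n M s = dots M s]
  /\
  (* (2) dots of the same colour interlace *)
  ((forall s j : nat, (s <= n - 1)%N -> (1 <= j)%N -> (j <= n - s - 1)%N ->
      eta (blue_dots n M s) j.+1 <= eta (blue_dots n M s.+1) j
      /\ eta (blue_dots n M s.+1) j <= eta (blue_dots n M s) j)
   /\
   (forall s j : nat, (n - rho <= s)%N -> (s <= 2 * n - rho - 1)%N ->
      (1 <= j)%N -> (j <= s + rho - n)%N ->
      eta (red_dots n M s.+1) j.+1 <= eta (red_dots n M s) j
      /\ eta (red_dots n M s) j <= eta (red_dots n M s.+1) j))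
  /\
  (* (3) in the overlap all dots interlace *)
  (forall s : nat, (n - rho < s)%N -> (s < n)%N ->
     (forall j : nat, (1 <= j)%N -> (j <= rho)%N ->
        eta (dots M s.+1) j <= eta (dots M s) j)
     /\
     (forall j : nat, (1 <= j)%N -> (j < rho)%N ->
        eta (dots M s) j.+1 <= eta (dots M s.+1) j)).
Proof.
have le_mn : (2 * m <= n)%N by lia.
have cardE s : (s <= 2 * m + n)%N ->
    #|` dots M s| = (n - minn s (2 * m) + (s - n))%N.
  by move=> le_s; apply: card_dots hM le_s le_mn.
have interlace_left s j := @dots_interlace_left n m M s j hM le_mn.
have interlace_right s j := @dots_interlace_right n m M s j hM le_mn.
split; last split; last 1 first.
- move=> s gt_s lt_s; split=> j j_gt0 le_j.
  + by have [+ _] := interlace_left s j lt_s j_gt0; apply; rewrite cardE; lia.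
  + by have [_] := interlace_left s j lt_s j_gt0; apply; rewrite cardE; lia.
- split.
  + move=> s lt_s.
    have card_s: #|` dots M s| = (n - s)%N by rewrite cardE; lia.
    by rewrite (blue_all hM) card_s.
  + have card_s: #|` dots M (n - rho)| = rho by rewrite cardE; lia.
    by split=> //; apply: (blue_all hM); rewrite card_s; lia.
  + move=> s gt_s lt_s; rewrite (card_blue _ hM) (card_red _ hM) cardE; last by lia.
    by split; try lia; apply: blue_right_of_red.
  + by split; [rewrite cardE; lia | apply: (red_all hM)].
  + move=> s gt_s le_s.
    by split; [rewrite cardE; lia | apply: (red_all hM); lia].
- split=> s j.
  + move=> le_s j_gt0 le_j; rewrite !(eta_blue hM); try lia.
    have lt_s: (s < n)%N by lia.
    by have [le1 le2] := interlace_left s j lt_s j_gt0; split; [apply: le2 | apply: le1];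
      rewrite cardE; lia.
  + move=> ge_s le_s j_gt0 le_j; rewrite !(eta_red _ hM) //.
    case: (ltnP s n) => [lt_s | le_ns].
      (* With the shift by the number of blue dots, the red indices [j + 1] and
         [j] on the line [s + 1] become [n - s + j] and [n - s + j - 1]. *)
      have eq_i : (n - s.+1 + j.+1 = n - s + j)%N by lia.
      have [i def_i] : exists i, (n - s + j = i.+1)%N by exists (n - s + j).-1; lia.
      have eq_i' : (n - s.+1 + j = i)%N by lia.
      have i_gt0 : (0 < i)%N by lia.
      rewrite eq_i def_i eq_i'; split.
        by have [+ _] := interlace_left s i.+1 lt_s isT; apply; rewrite cardE; lia.
      by have [_] := interlace_left s i lt_s i_gt0; apply; rewrite cardE; lia.
    have [-> ->] : (n - s = 0)%N /\ (n - s.+1 = 0)%N by lia.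
    by rewrite !add0n; apply: interlace_right; rewrite ?cardE; lia.
Qed.
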